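(* Let $n,N$ be positive integers and for $i=1,\dots,N$ let $C^i,B^i\in\mathbb{R}^{n\times m_i}$ be real matrices. Let $\bar R$ be the generalized average rotation $$\bar R:=\arg\min_{R\in SO(n)}\ \sum_{i=1}^N\|C^i-RB^i\|_F^2 ,$$ where it is assumed that this minimizer is unique. Then $\bar R$ is also the unique solution of the convex problem $$\bar R=\arg\max_{R\in \mathrm{conv}(SO(n))}\ \left\langle \frac1N\sum_{i=1}^N C^i(B^i)^\top,\ R\right\rangle .$$
   Context: $SO(n)=\{R\in\mathbb{R}^{n\times n}: R^\top R=I,\ \det R=1\}$; $\mathrm{conv}(SO(n))$ is its convex hull in $\mathbb{R}^{n\times n}$. For real matrices of equal size, $\langle A,B\rangle=\mathrm{trace}(A^\top B)$ and $\|A\|_F^2=\langle A,A\rangle$. *)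

(* Defs.v *)
From mathcomp Require Import all_boot all_order all_algebra.
From mathcomp Require Import boolp classical_sets reals convex.
Set Implicit Arguments.
Unset Strict Implicit.
Unset Printing Implicit Defensive.
Import Order.TTheory GRing.Theory Num.Theory.
Local Open Scope classical_set_scope.
Local Open Scope ring_scope.

Definition SO (R : realType) (n : nat) : set 'M[R]_n :=
  [set Q | Q^T *m Q = 1%:M /\ \det Q = 1].

Arguments SO : clear implicits.

Definition convex_hull (R : realType) (V : lmodType R) (A : set V) : set V :=
  smallest (@convex_set R V) A.

Definition frob_inner (R : realType) (m n : nat) (A B : 'M[R]_(m, n)) : R :=
  \tr (A^T *m B).

Definition frob_sqnorm (R : realType) (m n : nat) (A : 'M[R]_(m, n)) : R :=
  frob_inner A A.

(* The sets of all global minimizers / maximizers of f over D; a minimizer x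
   is unique exactly when [argmin D f = [set x]]. *)
Definition argmin (R : realType) (T : Type) (D : set T) (f : T -> R) : set T :=
  [set x | D x /\ forall y, D y -> f x <= f y].

Definition argmax (R : realType) (T : Type) (D : set T) (f : T -> R) : set T :=
  [set x | D x /\ forall y, D y -> f y <= f x].

(* Main.v *)
Require Import Defs.
From HB Require Import structures.
From mathcomp Require Import all_boot all_order all_algebra.
From mathcomp Require Import lra.
From mathcomp Require Import boolp classical_sets interval_inference reals convex.
Import Order.TTheory GRing.Theory Num.Theory.
Local Open Scope classical_set_scope.
Local Open Scope ring_scope.

(** On [SO n] one has [|C - Q B|^2 = |C|^2 + |B|^2 - 2 <C B^T, Q>], so the
    least-squares problem is the maximization of a linear functional [g] over
    [SO n].  If a linear [g] has a unique maximizer [x] on a set [A], then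
    [x] together with the open half-space [g < g x] is a convex set containing
    [A], hence containing its convex hull. *)

Lemma frob_inner_is_scalar (R : realType) (m n : nat) (A : 'M[R]_(m, n)) :
  scalar (frob_inner A).
Proof. by move=> a X Y; rewrite /frob_inner mulmxDr -scalemxAr mxtraceD mxtraceZ. Qed.

(** Gives access to the generic linearity lemmas in the second argument, and lets [frob_inner A]
    serve as the [{scalar V}] of [argmax_convex_hull]. *)
HB.instance Definition _ (R : realType) (m n : nat) (A : 'M[R]_(m, n)) :=
  GRing.isLinear.Build R 'M[R]_(m, n) R _ (frob_inner A) (frob_inner_is_scalar R m n A).

Lemma frob_innerC (R : realType) (m n : nat) (A B : 'M[R]_(m, n)) :
  frob_inner A B = frob_inner B A.
Proof. by rewrite /frob_inner -mxtrace_tr trmx_mul trmxK. Qed.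

Lemma frob_innerZl (R : realType) (m n : nat) (a : R) (A B : 'M[R]_(m, n)) :
  frob_inner (a *: A) B = a * frob_inner A B.
Proof. by rewrite frob_innerC linearZ /= frob_innerC. Qed.

Lemma frob_inner_suml (R : realType) (m n : nat) (I : finType)
    (A : I -> 'M[R]_(m, n)) (B : 'M[R]_(m, n)) :
  frob_inner (\sum_i A i) B = \sum_i frob_inner (A i) B.
Proof. by rewrite frob_innerC linear_sum; apply: eq_bigr => i _; rewrite frob_innerC. Qed.

(** Cyclicity of the trace; this isolates [Q] in the cross term. *)
Lemma frob_inner_mulr (R : realType) (m n p : nat) (A : 'M[R]_(m, p))
    (Q : 'M[R]_(m, n)) (B : 'M[R]_(n, p)) :
  frob_inner A (Q *m B) = frob_inner (A *m B^T) Q.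
Proof. by rewrite /frob_inner trmx_mul trmxK mulmxA mxtrace_mulC mulmxA. Qed.

Lemma frob_sqnormB (R : realType) (m n : nat) (A B : 'M[R]_(m, n)) :
  frob_sqnorm (A - B) = frob_sqnorm A + frob_sqnorm B - 2 * frob_inner A B.
Proof.
(* Linearity is registered on the right only, so symmetry brings the left difference there. *)
rewrite /frob_sqnorm linearB /= !(frob_innerC _ _ _ (A - B)) !linearB /=.
rewrite (frob_innerC _ _ _ B A); lra.
Qed.

Lemma frob_sqnorm_isometry (R : realType) (m n p : nat) (Q : 'M[R]_(m, n))
    (B : 'M[R]_(n, p)) : Q^T *m Q = 1%:M -> frob_sqnorm (Q *m B) = frob_sqnorm B.
Proof.
by move=> QQ; rewrite /frob_sqnorm /frob_inner trmx_mul mulmxA -(mulmxA B^T) QQ mulmx1.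
Qed.

Lemma sum_frob_sqnorm_SO (R : realType) (n N : nat) (m : 'I_N -> nat)
    (C B : forall i : 'I_N, 'M[R]_(n, m i)) (Q : 'M[R]_n) :
  SO R n Q ->
  \sum_(i < N) frob_sqnorm (C i - Q *m B i) =
  \sum_(i < N) (frob_sqnorm (C i) + frob_sqnorm (B i))
    - 2 * frob_inner (\sum_(i < N) C i *m (B i)^T) Q.
Proof.
case=> QQ _; rewrite frob_inner_suml mulr_sumr -sumrB; apply: eq_bigr => i _.
by rewrite frob_sqnormB frob_sqnorm_isometry // frob_inner_mulr.
Qed.

(** The identity is asked on [A] alone because the least-squares expansion relies on [Q] being
    orthogonal. *)
Lemma argmin_sub_scale (R : realType) (T : Type) (A : set T) (f g : T -> R)
    (a b : R) :
  0 < b -> (forall x, A x -> f x = a - b * g x) -> argmin A f = argmax A g.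
Proof.
move=> b_gt0 fE; apply/seteqP; split=> x [Ax xopt]; split=> // y Ay.
  by have := xopt y Ay; rewrite !fE // lerD2l lerN2 ler_pM2l.
by rewrite !fE // lerD2l lerN2 ler_pM2l //; exact: xopt.
Qed.

Lemma argmax_scale (R : realType) (T : Type) (A : set T) (f g : T -> R) (c : R) :
  0 < c -> (forall x, f x = c * g x) -> argmax A f = argmax A g.
Proof.
move=> c_gt0 fE; apply/seteqP; split=> x [Ax xopt]; split=> // y Ay.
  by have := xopt y Ay; rewrite !fE ler_pM2l.
by rewrite !fE ler_pM2l //; exact: xopt.
Qed.

(** Turns uniqueness into an inclusion of [A] in a fixed set, the form that minimality of the hull
    can use. *)
Lemma argmax_set1_lt (R : realType) (T : Type) (A : set T) (f : T -> R) (x : T) :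
  argmax A f = [set x] <-> A x /\ (forall y, A y -> y = x \/ f y < f x).
Proof.
split=> [fE|[Ax ltx]].
  have [Ax xopt] : argmax A f x by rewrite fE.
  (* If [f x <= f y], then [y] is a maximizer too, hence equals [x]. *)
  split=> // y Ay; have [lt_yx|le_xy] := ltP (f y) (f x); [by right|left].
  have : argmax A f y by split=> // z Az; apply: le_trans le_xy; exact: xopt.
  by rewrite fE.
apply/seteqP; split=> [y [Ay yopt]|_ ->].
  by have [//|] := ltx y Ay; rewrite ltNge yopt.
by split=> // y /ltx[->|/ltW].
Qed.

Lemma convex_set_scalar_lt (R : realType) (V : lmodType R) (g : {scalar V}) (x : V) :
  convex_set [set y : convex_lmodType V | y = x \/ g y < g x].
Proof.
apply/convex_setW => y z; rewrite !inE /= => yx zx k k_gt0 k_lt1; rewrite inE /=.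
have gE : g (k%:num *: y + (1 - k%:num) *: z) = k%:num * g y + (1 - k%:num) * g z.
  by rewrite linearD !linearZ.
(* Two copies of [x] average to [x]. Otherwise a point with value below [g x] has positive weight,
   as [0 < k < 1], so the average is strictly below [g x]. *)
case: yx zx gE => [->|yx] [->|zx] gE; first by left; rewrite convmm.
all: right; rewrite [X in X < _]gE; nra.
Qed.

Lemma argmax_convex_hull (R : realType) (V : lmodType R) (A : set V)
    (g : {scalar V}) (x : V) :
  argmax A g = [set x] -> argmax (convex_hull A) g = [set x].
Proof.
move=> /argmax_set1_lt[Ax ltx]; apply/argmax_set1_lt.
split; first exact: sub_gen_smallest.
(* [ltx] says that [A] lies in this convex set, so the hull does too. *)
exact: (smallest_sub (convex_set_scalar_lt R V g x) ltx).
Qed.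

Theorem lemma1 (R : realType) (n N : nat) (n_gt0 : (0 < n)%N) (N_gt0 : (0 < N)%N)
    (m : 'I_N -> nat) (C B : forall i : 'I_N, 'M[R]_(n, m i)) (Rbar : 'M[R]_n)
    (RbarE : argmin (SO R n)
       (fun Q : 'M[R]_n => \sum_(i < N) frob_sqnorm (C i - Q *m B i)) = [set Rbar]) :
  argmax (convex_hull (SO R n))
    (fun Q : 'M[R]_n =>
       frob_inner (N%:R^-1 *: \sum_(i < N) (C i *m (B i)^T)) Q) = [set Rbar].
Proof.
pose M := \sum_(i < N) (C i *m (B i)^T).
have N_inv_gt0 : 0 < N%:R^-1 :> R by rewrite invr_gt0 ltr0n.
rewrite (argmax_scale _ _ _ _ (frob_inner M) _ N_inv_gt0); last first.
  by move=> Q; rewrite frob_innerZl.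
apply: argmax_convex_hull; rewrite -RbarE; apply/esym.
(* The factor 2 is that of the cross term; the constant is the sum of the squared norms of all [C i]
   and [B i]. *)
by apply: (argmin_sub_scale _ _ _ _ _ _ 2) => // Q; exact: sum_frob_sqnorm_SO.
Qed.
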